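(* Let $f$ be an octonion-valued slice regular function on a symmetric slice domain $\Omega\subseteq\mathbb O$ such that $f(\Omega_I)\subseteq\mathbb C_I$ for some $I\in\mathbb S$. Then the convex combination identity $$\big|f(x+yJ)\big|^2=\frac{1+\langle I,J\rangle}{2}\big|f(x+yI)\big|^2+\frac{1-\langle I,J\rangle}{2}\big|f(x-yI)\big|^2$$ holds for every $x+yJ\in\Omega$ (with $x,y\in\mathbb R$ and $J\in\mathbb S$).
   Context: $\mathbb O$ is the real division algebra of octonions, with norm $|w|$ and Euclidean inner product $\langle z,w\rangle=\mathrm{Re}(z\bar w)$. $\mathbb S=\{w\in\mathbb O:w^2=-1\}$; for $I\in\mathbb S$, $\mathbb C_I=\mathbb R\oplus I\mathbb R$ and $\Omega_I=\Omega\cap\mathbb C_I$. $f:\Omega\to\mathbb O$ on a domain $\Omega\subseteq\mathbb O$ is slice regular if for every $I\in\mathbb S$ its restriction $f_I$ to $\Omega_I$ has continuous partial derivatives and $\frac12(\frac{\partial}{\partial x}+I\frac{\partial}{\partial y})f_I(x+yI)=0$ on $\Omega_I$. A symmetric slice domain is a domain $\Omega\subseteq\mathbb O$ that intersects the real axis, such that $\Omega_I$ is a domain in $\mathbb C_I$ for every $I\in\mathbb S$, and such that $x+yI\in\Omega$ implies $x+y\mathbb S\subseteq\Omega$. *)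

(* Defs.v *)
From HB Require Import structures.
From mathcomp Require Import all_boot all_order all_algebra.
From mathcomp Require Import all_classical all_reals all_analysis.

Set Implicit Arguments.
Unset Strict Implicit.
Unset Printing Implicit Defensive.

Import Order.TTheory GRing.Theory Num.Theory.
Import numFieldNormedType.Exports.

Local Open Scope classical_set_scope.
Local Open Scope ring_scope.

(* Cayley-Dickson doubling on coordinate vectors of length 2 ^ n, with
   (a, b) (c, d) = (a c - d^* b, d a + b c^* ) and (a, b)^* = (a^*, - b). *)

Fixpoint cd_dim (n : nat) : nat :=
  if n is m.+1 then (cd_dim m + cd_dim m)%N else 1%N.

Fixpoint cd_conj (R : realType) (n : nat) :
    'rV[R]_(cd_dim n) -> 'rV[R]_(cd_dim n) :=
  match n with
  | 0 => fun z => z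
  | m.+1 => fun z : 'rV[R]_(cd_dim m + cd_dim m) =>
      row_mx (@cd_conj R m (lsubmx z)) (- rsubmx z)
  end.

Fixpoint cd_mul (R : realType) (n : nat) :
    'rV[R]_(cd_dim n) -> 'rV[R]_(cd_dim n) -> 'rV[R]_(cd_dim n) :=
  match n with
  | 0 => fun z w => z *m w
  | m.+1 => fun z w : 'rV[R]_(cd_dim m + cd_dim m) =>
      let a := lsubmx z in let b := rsubmx z in
      let c := lsubmx w in let d := rsubmx w in
      row_mx (cd_mul a c - cd_mul (cd_conj d) b)
             (cd_mul d a + cd_mul b (cd_conj c))
  end.

(* The topology is the one of 'rV[R]_8. The library norm `|w| on this type is
   the sup norm; the Euclidean norm is onorm below. *)
Notation octonion R := 'rV[R]_8.

Definition omul (R : realType) (z w : octonion R) : octonion R :=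
  @cd_mul R 3 z w.

Definition oconj (R : realType) (z : octonion R) : octonion R :=
  @cd_conj R 3 z.

Definition oone (R : realType) : octonion R := delta_mx 0 0.
Arguments oone {R}.

Definition oRe (R : realType) (z : octonion R) : R := z 0 0.

Definition oinner (R : realType) (z w : octonion R) : R :=
  oRe (omul z (oconj w)).

Definition onorm (R : realType) (z : octonion R) : R :=
  Num.sqrt (oinner z z).

Definition oimag (R : realType) : set (octonion R) :=
  [set w | omul w w = - oone].
Arguments oimag {R}.

(* x + y I *)
Definition opoint (R : realType) (I : octonion R) (x y : R) : octonion R :=
  x *: oone + y *: I.

(* C_I *)
Definition oslice (R : realType) (I : octonion R) : set (octonion R) :=
  [set w | exists x y : R, w = opoint I x y].

Definition domain (T : topologicalType) (A : set T) : Prop :=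
  [/\ A !=set0, open A & connected A].

(* A is a domain of the subspace S of T; connectedness of a subset does not
   depend on the ambient space. *)
Definition domain_in (T : topologicalType) (S A : set T) : Prop :=
  [/\ A !=set0, exists2 U : set T, open U & A = S `&` U & connected A].

Definition symmetric_slice_domain (R : realType) (Omega : set (octonion R)) :
    Prop :=
  [/\ domain Omega,
      exists x : R, Omega (x *: oone),
      forall I, oimag I -> domain_in (oslice I) (Omega `&` oslice I) &
      forall x y I, oimag I -> Omega (opoint I x y) ->
        forall J, oimag J -> Omega (opoint J x y)].

(* Partial derivatives of (x, y) |-> f (x + y I). *)
Definition slice_dx (R : realType) (f : octonion R -> octonion R)
    (I : octonion R) (p : R * R) : octonion R :=
  derive1 (fun t : R => f (opoint I t p.2)) p.1.

Definition slice_dy (R : realType) (f : octonion R -> octonion R)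
    (I : octonion R) (p : R * R) : octonion R :=
  derive1 (fun t : R => f (opoint I p.1 t)) p.2.

(* Only the values of f on Omega matter, since Omega is open. *)
Definition slice_regular (R : realType) (Omega : set (octonion R))
    (f : octonion R -> octonion R) : Prop :=
  domain Omega /\
  forall I, oimag I -> forall x y : R, Omega (opoint I x y) ->
    [/\ derivable (fun t : R => f (opoint I t y)) x 1,
        derivable (fun t : R => f (opoint I x t)) y 1,
        {for (x, y), continuous (slice_dx f I)},
        {for (x, y), continuous (slice_dy f I)} &
        2^-1 *: (slice_dx f I (x, y) + omul I (slice_dy f I (x, y))) = 0].

(* Main.v *)
(* Write f_K (x, y) = f (x + y K) for an imaginary unit K. The map
   g = (f_I + f_{-I}) / 2 + J (I (f_{-I} - f_I)) / 2 solves the same equation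
   g_x + J g_y = 0 as f_J and agrees with f_J on the real axis, so f_J = g by
   the identity theorem for holomorphic functions of one variable. Since f_I
   and f_{-I} take values in C_I, the norm of g is computed by expanding a
   square.

   The identity theorem is obtained without integration. The mean value
   property over a circle follows from Riemann sums over inscribed regular
   polygons. If h vanishes on an arc of a circle, the product of finitely many
   rotated copies of h vanishes on the whole circle, hence h vanishes at the
   centre. So the interior of the zero set of h is relatively closed. That it
   is nonempty when h vanishes on a real interval is the same argument applied
   to h extended by zero below the real axis. *)

Require Import Defs.
From HB Require Import structures.
From mathcomp Require Import all_boot all_order all_algebra.
From mathcomp Require Import all_classical all_reals all_analysis.
From mathcomp Require Import complex ring lra.

Set Implicit Arguments.
Unset Strict Implicit.
Unset Printing Implicit Defensive.

Import Order.TTheory GRing.Theory Num.Theory.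
Import numFieldNormedType.Exports.
Import ComplexField.Normc.

Local Open Scope classical_set_scope.
Local Open Scope ring_scope.
Local Open Scope complex_scope.

(** * The modulus of complex numbers and fine roots of unity *)

Section ComplexNorm.
Variable R : realType.
Implicit Types z w : R[i].

Lemma normcD z w : normc (z + w) <= normc z + normc w.
Proof. exact: le_normcD. Qed.

Lemma normc_opp z : normc (- z) = normc z.
Proof. exact: normcN. Qed.

Lemma normcBC z w : normc (z - w) = normc (w - z).
Proof. by rewrite -normc_opp opprB. Qed.

Lemma normc_triangle u z w : normc (z - w) <= normc (z - u) + normc (u - w).
Proof. by rewrite (_ : z - w = (z - u) + (u - w)) ?normcD// addrA subrK. Qed.

Lemma normc_ge0 z : 0 <= normc z.
Proof. by case: z => a b; exact: sqrtr_ge0. Qed.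

Lemma normc_gt0 z : (0 < normc z) = (z != 0).
Proof.
rewrite lt_def normc_ge0 andbT; congr negb.
by apply/eqP/eqP => [/eq0_normc//|->]; exact: normc0.
Qed.

Lemma normcX z n : normc (z ^+ n) = normc z ^+ n.
Proof. by elim: n => [|n ih]; rewrite ?expr0 ?normc1// !exprS normcM ih. Qed.

Lemma normc_real (x : R) : normc x%:C = `|x|.
Proof. by rewrite /normc /= expr0n addr0 sqrtr_sqr. Qed.

Lemma normc_nat n : normc (n%:R : R[i]) = n%:R.
Proof. by rewrite -(rmorph_nat (real_complex R)) normc_real normr_nat. Qed.

Lemma normc_sum_le n (F : 'I_n -> R[i]) (c : R) :
  (forall k, normc (F k) <= c) -> normc (\sum_k F k) <= n%:R * c.
Proof.
move=> Fc; rewrite mulr_natl -[n in leRHS]card_ord -sumr_const.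
apply: (big_ind2 (fun z x => normc z <= x)) => //; first by rewrite normc0.
by move=> z x w y zx wy; apply: le_trans (normcD _ _) (lerD zx wy).
Qed.

Lemma normc_sqr z : normc z ^+ 2 = complex.Re z ^+ 2 + complex.Im z ^+ 2.
Proof. by case: z => a b; rewrite sqr_sqrtr// addr_ge0 ?sqr_ge0. Qed.

Lemma normc_le_ReIm z : normc z <= `|complex.Re z| + `|complex.Im z|.
Proof.
rewrite -(@ler_pXn2r _ 2)// ?nnegrE ?normc_ge0 ?addr_ge0//.
rewrite normc_sqr sqrrD !real_normK ?num_real//.
by rewrite -addrA lerD2l lerDr mulrn_wge0// mulr_ge0.
Qed.

Lemma normRe_le z : `|complex.Re z| <= normc z.
Proof.
rewrite -(@ler_pXn2r _ 2)// ?nnegrE ?normc_ge0//.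
by rewrite normc_sqr real_normK ?num_real// lerDl sqr_ge0.
Qed.

Lemma normIm_le z : `|complex.Im z| <= normc z.
Proof.
rewrite -(@ler_pXn2r _ 2)// ?nnegrE ?normc_ge0//.
by rewrite normc_sqr real_normK ?num_real// lerDr sqr_ge0.
Qed.

Lemma normc_parallelogram z w :
  normc (z - w) ^+ 2 + normc (z + w) ^+ 2 = 2 * (normc z ^+ 2 + normc w ^+ 2).
Proof. by rewrite !normc_sqr; case: z w => [a b] [c d] /=; ring. Qed.

End ComplexNorm.

Section FineRoots.
Variable R : realType.

Let sqr2V_half (n : nat) (x y : R) : 2 <= y -> 0 <= x ->
  x * y <= 4 / 2 ^+ n -> x <= 4 / 2 ^+ n.+1.
Proof.
move=> y2 x0 xy; rewrite exprSr invfM mulrA ler_pdivlMr//.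
by apply: le_trans xy; rewrite ler_wpM2l.
Qed.

(* Halving the angle: taking the square root with nonnegative real part at
   least halves the squared distance to 1, since [|w + 1| ^ 2 >= 2]. *)
Lemma fine_root_pow2 n : exists w : R[i],
  [/\ w ^+ (2 ^ n) = -1, normc w = 1, normc (w - 1) ^+ 2 <= 4 / 2 ^+ n &
      forall u, normc u = 1 ->
        exists k, normc (u - w ^+ k) ^+ 2 <= 4 / 2 ^+ n].
Proof.
elim: n => [|n [w [wn w1 wd wc]]].
  exists (-1); rewrite expn0 expr1 normc_opp normc1 expr0 divr1; split => //.
    by rewrite -opprD normc_opp -(natrD _ 1 1) normc_nat -natrX.
  move=> u u1; exists 0%N; rewrite expr0 -[4]/((2 * 2)%N%:R) natrM -expr2.
  rewrite ler_pXn2r// ?nnegrE ?normc_ge0//.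
  by apply: le_trans (normcD _ _) _; rewrite normc_opp normc1 u1.
have [v vw rv] : exists2 v : R[i], v ^+ 2 = w & 0 <= complex.Re v.
  have [s0|s0] := leP 0 (complex.Re (sqrtC w)).
    by exists (sqrtC w) => //; exact: sqrtCK.
  exists (- sqrtC w); first by rewrite sqrrN sqrtCK.
  by move: s0; case: (sqrtC w) => a b /= /ltW; rewrite oppr_ge0.
have v1 : normc v = 1.
  apply/eqP; rewrite -(@eqrXn2 _ 2)// ?normc_ge0//.
  by rewrite expr1n -normcX vw w1.
have vn : v ^+ (2 ^ n.+1) = -1 by rewrite expnS exprM vw.
exists v; split => //.
  apply: (@sqr2V_half _ _ (normc (v + 1) ^+ 2)).
  - move: rv (normc_sqr v) (normc_sqr (v + 1)); rewrite v1.
    by case: v {vw v1 vn} => a b /= a0; rewrite addr0 => ab ->; nra.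
  - exact: sqr_ge0.
  - by rewrite -exprMn -normcM -subr_sqr_1 vw.
(* If [w ^ k] is near [u ^ 2], then [(u - v ^ k) (u + v ^ k)] is small. By the parallelogram law the
   squared moduli of the two factors add up to 4, so one of them is at least 2 and the other gets
   the halved bound. *)
move=> u u1; have [|k uk] := wc (u ^+ 2); first by rewrite normcX u1 expr1n.
have vk : normc (v ^+ k) = 1 by rewrite normcX v1 expr1n.
have := normc_parallelogram u (v ^+ k); rewrite u1 vk expr1n => uv.
have {}uk : normc (u - v ^+ k) ^+ 2 * normc (u + v ^+ k) ^+ 2 <= 4 / 2 ^+ n.
  by rewrite -exprMn -normcM -subr_sqr -exprM mulnC exprM vw.
have [ge2|lt2] := leP 2 (normc (u + v ^+ k) ^+ 2).
  by exists k; apply: sqr2V_half ge2 (sqr_ge0 _) uk.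
(* Adding [2 ^ n.+1] to the exponent replaces [v ^ k] by its opposite. *)
exists (k + 2 ^ n.+1)%N; rewrite exprD vn mulrN1 opprK.
apply: sqr2V_half (sqr_ge0 _) _; last by rewrite mulrC; exact: uk.
by lra.
Qed.

(** The witness satisfies [w ^ (2 ^ n) = -1] with [4 / 2 ^ n < d ^ 2]. Hence [N = 2 ^ n.+1] works,
    and exponents can be reduced modulo [N]. *)
Lemma fine_root (d : R) : 0 < d -> exists N (w : R[i]),
  [/\ (0 < N)%N, w ^+ N = 1, w != 1, normc w = 1 & normc (w - 1) < d] /\
  forall u, normc u = 1 -> exists k : 'I_N, normc (u - w ^+ k) < d.
Proof.
move=> d0; have d2 : 0 < d ^+ 2 by rewrite exprn_gt0.
have [n nd] : exists n : nat, 4 / 2 ^+ n < d ^+ 2.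
  have [n hn] : exists n : nat, 4 / d ^+ 2 < n%:R.
    exists (Num.bound (4 / d ^+ 2)).
    by rewrite archi_boundP// divr_ge0// ltW.
  exists n; rewrite ltr_pdivrMr ?exprn_gt0// mulrC -ltr_pdivrMr//.
  by apply: lt_trans hn _; rewrite -natrX ltr_nat ltn_expl.
have [w [wn w1 wd wc]] := fine_root_pow2 n.
have small (z : R[i]) : normc z ^+ 2 <= 4 / 2 ^+ n -> normc z < d.
  move=> zn; rewrite -(@ltr_pXn2r _ 2)// ?nnegrE ?normc_ge0 ?ltW//.
  exact: le_lt_trans nd.
have wN : w ^+ (2 ^ n.+1) = 1 by rewrite expnS mulnC exprM wn sqrrN expr1n.
exists (2 ^ n.+1)%N, w; split; first split => //.
- by rewrite expn_gt0.
- apply/eqP => we; move/eqP: wn; rewrite we expr1n -subr_eq0 opprK.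
  by rewrite -(natrD _ 1 1) pnatr_eq0.
- exact: small.
move=> u /wc[k uk].
have kN : (k %% 2 ^ n.+1 < 2 ^ n.+1)%N by rewrite ltn_mod expn_gt0.
by exists (Ordinal kN); apply: small; rewrite /= expr_mod.
Qed.

End FineRoots.

Local Arguments normc : simpl never.

(** * Strict complex differentiability *)

Section StrictDifferentiability.
Variable R : realType.
Implicit Types (h : R[i] -> R[i]) (a z w p : R[i]).

(** Both end points move, so that one derivative serves all base points near [p]. This gives
    uniformity on discs by compactness, without continuity of the derivative. *)
Definition strict_derive h a p := forall e : R, 0 < e -> exists2 d : R, 0 < d &
  forall z w, normc (z - p) < d -> normc (w - p) < d ->
    normc (h w - h z - a * (w - z)) <= e * normc (w - z).

Definition strict_derivable h p := exists a, strict_derive h a p.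

Lemma strict_derivable_cst c p : strict_derivable (fun=> c) p.
Proof.
exists 0 => e e0; exists 1 => // z w _ _.
by rewrite subrr sub0r mul0r oppr0 normc0 mulr_ge0 ?normc_ge0 ?ltW.
Qed.

Lemma strict_derive_lipschitz h a p : strict_derive h a p ->
  exists2 d : R, 0 < d & forall z w, normc (z - p) < d -> normc (w - p) < d ->
    normc (h w - h z) <= (normc a + 1) * normc (w - z).
Proof.
move=> /(_ 1 ltr01)[d d0 hd]; exists d => // z w zp wp.
rewrite -(subrK (a * (w - z)) (h w - h z)) mulrDl addrC.
apply: le_trans (normcD _ _) _; rewrite normcM lerD2l; exact: hd.
Qed.

Lemma strict_derivableM h1 h2 p : strict_derivable h1 p ->
  strict_derivable h2 p -> strict_derivable (fun z => h1 z * h2 z) p.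
Proof.
move=> [a1 D1] [a2 D2]; exists (h1 p * a2 + a1 * h2 p) => e e0.
have [d1 d10 L1] := strict_derive_lipschitz D1.
have [d2 d20 L2] := strict_derive_lipschitz D2.
pose M := normc (h1 p) + normc (h2 p) + normc a1 + normc a2 + 2.
have [n1 n2] := (normc_ge0 (h1 p), normc_ge0 (h2 p)).
have [m1 m2] := (normc_ge0 a1, normc_ge0 a2).
have M0 : 0 < M by rewrite /M; lra.
have M1 : 1 <= M by rewrite /M; lra.
(* The error for the product is cut below into four terms, each at most [e' * M * normc (w - z)]. *)
pose e' := e / (4 * M).
have e'0 : 0 < e' by rewrite divr_gt0// mulr_gt0.
have e'M : e' * M * 4 = e.
  by rewrite /e' -mulrA (mulrC M) divfK// lt0r_neq0// mulr_gt0.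
have [c1 c10 C1] := D1 _ e'0; have [c2 c20 C2] := D2 _ e'0.
(* Within this radius [M * normc (x - p)] is at most [e'] and at most 1. *)
pose b := Num.min (e' / M) (Num.min 1 M^-1).
have b0 : 0 < b by rewrite !lt_min ltr01 invr_gt0 divr_gt0// M0.
exists (Num.min b (Num.min (Num.min d1 d2) (Num.min c1 c2))).
  by rewrite lt_min b0 !lt_min d10 d20 c10 c20.
move=> z w; rewrite /b !lt_min.
move=> /andP[/and3P[zb1 zb2 zb3] /andP[/andP[zd1 zd2] /andP[zc1 zc2]]].
move=> /andP[/and3P[wb1 wb2 wb3] /andP[/andP[wd1 wd2] /andP[wc1 wc2]]].
have p0 (d : R) : 0 < d -> normc (p - p) < d by rewrite subrr normc0.
have hw : normc (h1 w - h1 p) <= M * normc (w - p).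
  apply: le_trans (L1 _ _ (p0 _ d10) wd1) _.
  by rewrite ler_wpM2r ?normc_ge0// /M; lra.
have hz : normc (h2 z - h2 p) <= M * normc (z - p).
  apply: le_trans (L2 _ _ (p0 _ d20) zd2) _.
  by rewrite ler_wpM2r ?normc_ge0// /M; lra.
have small x : normc (x - p) < e' / M -> M * normc (x - p) <= e'.
  by move=> /ltW; rewrite ler_pdivlMr// mulrC.
have small1 x : normc (x - p) < M^-1 -> M * normc (x - p) <= 1.
  by move=> /ltW; rewrite -[M^-1]mul1r ler_pdivlMr// mulrC.
have h1w : normc (h1 w) <= M.
  rewrite -(subrK (h1 p) (h1 w)); apply: le_trans (normcD _ _) _.
  by have := le_trans hw (small1 _ wb3); rewrite /M; lra.
have h2z : normc (h2 z) <= M.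
  rewrite -(subrK (h2 p) (h2 z)); apply: le_trans (normcD _ _) _.
  by have := le_trans hz (small1 _ zb3); rewrite /M; lra.
rewrite (_ : _ - _ = (h1 w - h1 p) * a2 * (w - z) +
    h1 w * (h2 w - h2 z - a2 * (w - z)) +
    (h1 w - h1 z - a1 * (w - z)) * h2 z +
    a1 * (h2 z - h2 p) * (w - z)); last by ring.
have q0 := normc_ge0 (w - z).
have B (s t u v : R[i]) (x : R) : normc s <= x -> normc t <= x ->
    normc u <= x -> normc v <= x -> normc (s + t + u + v) <= x * 4.
  move=> sx tx ux vx; apply: le_trans (normcD _ _) _.
  have := normcD (s + t) u; have := normcD s t; lra.
rewrite -e'M [leRHS]mulrAC; apply: B; rewrite !normcM.
- rewrite ler_wpM2r// ler_pM ?normc_ge0//; last by rewrite /M; lra.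
  exact: le_trans hw (small _ wb1).
- rewrite mulrC -(mulrAC e') ler_pM ?normc_ge0//; exact: C2.
- rewrite -(mulrAC e') ler_pM ?normc_ge0//; exact: C1.
- rewrite ler_wpM2r// mulrC ler_pM ?normc_ge0//; last by rewrite /M; lra.
  exact: le_trans hz (small _ zb1).
Qed.

Lemma strict_derivable_prod n (H : 'I_n -> R[i] -> R[i]) p :
  (forall k, strict_derivable (H k) p) ->
  strict_derivable (fun z => \prod_k H k z) p.
Proof.
elim: n H => [H _|n ih H HH].
  rewrite (_ : (fun z => _) = fun=> 1); first exact: strict_derivable_cst.
  by apply/funext => z; rewrite big_ord0.
rewrite (_ : (fun z => _) =
  fun z => H ord0 z * (\prod_(k < n) H (lift ord0 k) z)); last first.
  by apply/funext => z; rewrite big_ord_recl.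
by apply: strict_derivableM => //; apply: ih.
Qed.

Lemma strict_derivable_rot h p q w : normc w = 1 ->
  strict_derivable h (q + w * (p - q)) ->
  strict_derivable (fun z => h (q + w * (z - q))) p.
Proof.
move=> w1 [a D]; exists (a * w) => e /D[d d0 hd]; exists d => // z v zp vp.
have E x y : q + w * (x - q) - (q + w * (y - q)) = w * (x - y) by ring.
have := hd (q + w * (z - q)) (q + w * (v - q)).
by rewrite !E !normcM w1 !mul1r mulrA; exact.
Qed.

Lemma near_complex (q : R * R) (d : R) : 0 < d ->
  \forall q' \near q, normc (q'.1 +i* q'.2 - (q.1 +i* q.2)) < d.
Proof.
move=> d0; near=> q'; apply: le_lt_trans (normc_le_ReIm _) _ => /=.
rewrite [ltRHS]splitr ltrD//.
  near: q'; exists (ball q.1 (d / 2), setT) => /=.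
    by split; [apply: nbhsx_ballx; rewrite divr_gt0|exact: filterT].
  by move=> [x y] [/= + _]; rewrite distrC.
near: q'; exists (setT, ball q.2 (d / 2)) => /=.
  by split; [exact: filterT|apply: nbhsx_ballx; rewrite divr_gt0].
by move=> [x y] [/= _]; rewrite distrC.
Unshelve. all: by end_near. Qed.

(** Compactness of a square containing the disc. Near a point [q] of the disc, the derivative at [q]
    serves for all neighbouring points; near a point outside the disc the requirement is vacuous. *)
Lemma uniform_derivable h p (r : R) :
  (forall z, normc (z - p) <= r -> strict_derivable h z) ->
  forall e : R, 0 < e -> exists2 d : R, 0 < d &
    forall z, normc (z - p) <= r -> exists a, forall w, normc (w - z) < d ->
      normc (h w - h z - a * (w - z)) <= e * normc (w - z).
Proof.
move=> hr e e0; pose c (q : R * R) : R[i] := q.1 +i* q.2.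
pose K := `[complex.Re p - r, complex.Re p + r] `*`
          `[complex.Im p - r, complex.Im p + r].
pose P (d : R) (q : R * R) := normc (c q - p) <= r -> exists a, forall w,
  normc (w - c q) < d ->
  normc (h w - h (c q) - a * (w - c q)) <= e * normc (w - c q).
have : \forall d \near (0 : R)^'+, K `<=` P d.
  have /compact_near_coveringP cK : compact K.
    by apply: compact_setX; exact: segment_compact.
  apply: cK => q _; have [qr|qr] := leP (normc (c q - p)) r; last first.
    exists ([set q' | normc (c q' - c q) < normc (c q - p) - r], setT) => /=.
      by split; [apply: near_complex; rewrite subr_gt0|exact: filterT].
    move=> [q' d] [/= q'q _] q'r; exfalso.
    move: q'q; apply/negP; rewrite -leNgt.
    have := normc_triangle (c q') (c q) p.
    by rewrite (normcBC (c q) (c q')); lra.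
  have [a /(_ _ e0)[d d0 hd]] := hr _ qr.
  exists ([set q' | normc (c q' - c q) < d / 2], [set x | x < d / 2]) => /=.
    split; first by apply: near_complex; rewrite divr_gt0.
    by apply: nbhs_right_lt; rewrite divr_gt0.
  move=> [q' x] [/= q'q xd] _; exists a => w wq'; apply: hd; first by lra.
  have := normc_triangle (c q') w (c q); lra.
move=> Kd; have [d [d0 Pd]] : exists d : R, 0 < d /\ K `<=` P d.
  near (0 : R)^'+ => d; exists d; split; first by near: d; exact: nbhs_right_gt.
  by near: d.
exists d => // z zr.
have zE : z = c (complex.Re z, complex.Im z) by case: z {zr}.
have Kz : K (complex.Re z, complex.Im z).
  have zRe := le_trans (normRe_le (z - p)) zr.
  have zIm := le_trans (normIm_le (z - p)) zr.
  move: zRe zIm; rewrite /K; case: (z) (p) => [x y] [x' y'] /=.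
  rewrite !ler_norml => /andP[? ?] /andP[? ?].
  by split; rewrite /= in_itv/=; apply/andP; split; lra.
by have := Pd _ Kz; rewrite /P -zE; exact.
Unshelve. all: by end_near. Qed.

End StrictDifferentiability.

(** * Zeros on circles and arcs *)

Section ArcUniqueness.
Variable R : realType.
Implicit Types (h : R[i] -> R[i]) (z w p q : R[i]).

(* The mean value property, obtained by comparing Riemann sums over regular
   polygons inscribed in concentric circles. If [z_k = z_0 w ^ k] are the
   vertices of a fine polygon, the telescoping sum of the
   [h(p + t z_(k+1)) - h(p + t z_k)] vanishes and is close to [t (w - 1) S]
   with [S] the sum of the [h'(p + t z_k) z_k], so [S] is small; but [S] is
   the derivative in [t] of the sum of the [h(p + t z_k)]. *)
Lemma circle_zero h p (r : R) : 0 < r ->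
  (forall z, normc (z - p) <= r -> strict_derivable h z) ->
  (forall z, normc (z - p) = r -> h z = 0) -> h p = 0.
Proof.
move=> r0 hD h0; apply: eq0_normc; apply/eqP; rewrite eq_le normc_ge0 andbT.
apply/ler_addgt0Pl => e' e'0; rewrite addr0.
(* Chosen so that the final bound [2 * N * e * r] on the modulus of [N * h p] is [N * e']. *)
pose e := e' / (2 * r).
have e0 : 0 < e by rewrite divr_gt0// mulr_gt0.
have [d d0 hd] := uniform_derivable hD e0.
have [a ha] : exists a : R[i] -> R[i], forall z, normc (z - p) <= r -> forall w,
    normc (w - z) < d -> normc (h w - h z - a z * (w - z)) <= e * normc (w - z).
  have : forall z, exists a, normc (z - p) <= r -> forall w,
      normc (w - z) < d -> normc (h w - h z - a * (w - z)) <= e * normc (w - z).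
    move=> z; have [/hd[a ha]|zr] := leP (normc (z - p)) r; first by exists a.
    by exists 0.
  by move=> /choice[a ha]; exists a.
(* The sides of the polygon of radius [r] are shorter than [d], and so are those of the polygons
   scaled by [t <= 1]. *)
have [N [w [[N0 wN w_neq1 w1] [wd _]]]] := fine_root (divr_gt0 d0 r0).
rewrite ltr_pdivlMr// in wd.
pose z k := r%:C * w ^+ k.
have zr k : normc (z k) = r.
  by rewrite normcM normcX w1 expr1n mulr1 normc_real gtr0_norm.
have zS k : z k.+1 - z k = (w - 1) * z k by rewrite /z exprS; ring.
have w10 : w - 1 != 0 by rewrite subr_eq0.
have in_disc (t : R) k : 0 <= t <= 1 -> normc (p + t%:C * z k - p) <= r.
  move=> /andP[t0 t1]; rewrite addrAC subrr add0r normcM zr normc_real.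
  by rewrite ger0_norm// ler_piMl// ltW.
have tele (F : nat -> R[i]) : F N = F 0%N -> \sum_(k < N) (F k.+1 - F k) = 0.
  by move=> FN; rewrite -(big_mkord xpredT (fun k => F k.+1 - F k))
    telescope_sumr// FN subrr.
have zN : z N = z 0%N by rewrite /z wN expr0.
pose S t := \sum_(k < N) a (p + t%:C * z k) * z k.
(* At the centre the factor [a p] comes out. The vertices sum to zero, since [w - 1] times their sum
   telescopes and [w] is not 1. *)
have S0 : S 0 = 0.
  rewrite /S; under eq_bigr do rewrite mul0r addr0.
  rewrite -mulr_sumr; have /eqP := tele _ zN.
  under eq_bigr do rewrite zS.
  by rewrite -mulr_sumr mulf_eq0 (negPf w10) => /eqP ->; rewrite mulr0.
have S_small t : 0 <= t <= 1 -> normc (S t) <= N%:R * (e * r).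
  move=> t01; have [t0|t_neq0] := eqVneq t 0.
    by rewrite t0 S0 normc0 mulr_ge0 ?ler0n// mulr_ge0// ltW.
  have t0 : 0 < t by rewrite lt_def t_neq0; case/andP: t01.
  have tw0 : 0 < t * normc (w - 1) by rewrite mulr_gt0// normc_gt0.
  (* After multiplication by [t * (w - 1)], the terms of [S t] are the linear parts of increments of
     [h] along the sides. These increments telescope to zero, so only the errors remain. *)
  rewrite -(ler_pM2l tw0).
  have step k : p + t%:C * z k.+1 - (p + t%:C * z k) = t%:C * (w - 1) * z k.
    by rewrite -mulrA -zS; ring.
  have nstep k :
      normc (p + t%:C * z k.+1 - (p + t%:C * z k)) = t * normc (w - 1) * r.
    by rewrite step normcM zr normcM normc_real gtr0_norm.
  have -> : t * normc (w - 1) * normc (S t) = normc (\sum_(k < N)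
      (h (p + t%:C * z k.+1) - h (p + t%:C * z k) -
       a (p + t%:C * z k) * (p + t%:C * z k.+1 - (p + t%:C * z k)))).
    rewrite sumrB (tele (fun k => h (p + t%:C * z k))) ?zN// sub0r normc_opp.
    rewrite -{1}(gtr0_norm t0) -normc_real -!normcM; congr normc.
    by rewrite mulr_sumr; apply: eq_bigr => k _; rewrite step; ring.
  rewrite mulrCA; apply: normc_sum_le => k.
  apply: (le_trans (ha _ (in_disc _ _ t01) _ _)); rewrite nstep.
    apply: le_lt_trans wd; rewrite -mulrA.
    rewrite ler_piMl ?mulr_ge0 ?normc_ge0 ?(ltW r0)//.
    by case/andP: t01.
  by rewrite mulrCA.
pose F t := \sum_(k < N) h (p + t%:C * z k).
(* In a radial step of length [s * r < d], the linear parts add up to [s * S t], and the [N] errors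
   obey the same bound as this term; hence the factor 2. *)
have F_step t s : 0 <= t -> 0 <= s -> t + s <= 1 -> s * r < d ->
    normc (F (t + s) - F t) <= 2 * (N%:R * (e * r)) * s.
  move=> t0 s0 ts sd; have t01 : 0 <= t <= 1 by apply/andP; split; lra.
  have step k : p + (t + s)%:C * z k - (p + t%:C * z k) = s%:C * z k.
    by rewrite rmorphD/=; ring.
  have nstep k : normc (p + (t + s)%:C * z k - (p + t%:C * z k)) = s * r.
    by rewrite step normcM zr normc_real ger0_norm.
  have -> : F (t + s) - F t = \sum_(k < N)
      (h (p + (t + s)%:C * z k) - h (p + t%:C * z k) -
       a (p + t%:C * z k) * (p + (t + s)%:C * z k - (p + t%:C * z k))) +
      s%:C * S t.
    rewrite mulr_sumr -big_split /F -sumrB; apply: eq_bigr => k _ /=.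
    by rewrite step; ring.
  rewrite mulrDl mulrDl mul1r.
  apply: le_trans (normcD _ _) (lerD _ _); last first.
    rewrite normcM normc_real ger0_norm// mulrC ler_wpM2r//; exact: S_small.
  rewrite -mulrA; apply: normc_sum_le => k.
  apply: (le_trans (ha _ (in_disc _ _ t01) _ _)); rewrite nstep//.
  by rewrite -mulrA (mulrC r).
have F1 : F 1 = 0.
  rewrite /F big1// => k _; apply: h0.
  by rewrite mul1r addrAC subrr add0r zr.
have F0 : F 0 = N%:R * h p.
  rewrite /F; under eq_bigr do rewrite mul0r addr0.
  by rewrite sumr_const card_ord mulr_natl.
(* The radius is cut into [m] equal steps of length less than [d]. *)
pose m := Num.bound (r / d).
have rm : r < m%:R * d.
  by rewrite -ltr_pdivrMr// archi_boundP// divr_ge0// ltW.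
have m0 : 0 < m%:R :> R by rewrite -(pmulr_lgt0 _ d0); exact: lt_trans rm.
have F_grid j : (j <= m)%N ->
    normc (F (j%:R / m%:R) - F 0) <= 2 * (N%:R * (e * r)) * (j%:R / m%:R).
  elim: j => [_|j ih jm]; first by rewrite mul0r subrr normc0 mulr0.
  have jE : j.+1%:R / m%:R = j%:R / m%:R + m%:R^-1 :> R.
    by rewrite -natr1 mulrDl mul1r.
  apply: le_trans (normc_triangle (F (j%:R / m%:R)) _ _) _.
  rewrite jE mulrDr addrC lerD//; first by apply: ih; exact: ltnW.
  apply: F_step; rewrite ?divr_ge0 ?invr_ge0 ?ler0n//.
    by rewrite -jE ler_pdivrMr// mul1r ler_nat.
  by rewrite mulrC ltr_pdivrMr// mulrC.
have := F_grid m (leqnn m).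
rewrite divff ?lt0r_neq0// F1 F0 sub0r normc_opp normcM normc_nat mulr1.
rewrite mulrCA ler_pM2l ?ltr0n// mulrCA (_ : e * (2 * r) = e')//.
by rewrite divfK// lt0r_neq0// mulr_gt0.
Qed.

(** The circle used is the one about [p] through [q]. Some power of [w] rotates a given point of it
    to within [d] of [q], so one factor of [g] vanishes there; at the centre [g p] is [h p ^ N]. *)
Lemma arc_zero h p q (r d : R) : normc (q - p) <= r ->
  (forall z, normc (z - p) <= r -> strict_derivable h z) ->
  0 < d -> (forall z, normc (z - q) < d -> h z = 0) -> h p = 0.
Proof.
have [->|qp] := eqVneq q p; first by move=> _ _ d0; apply; rewrite subrr normc0.
move=> qr hD d0 hq; have r0 : 0 < normc (q - p) by rewrite normc_gt0 subr_eq0.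
have [N [w [[N0 wN _ w1] [_ wc]]]] := fine_root (divr_gt0 d0 r0).
pose g z := \prod_(k < N) h (p + w ^+ k * (z - p)).
have : g p = 0.
  apply: (circle_zero r0) => z zp.
    apply: strict_derivable_prod => k; apply: strict_derivable_rot.
      by rewrite normcX w1 expr1n.
    apply: hD; rewrite addrAC subrr add0r normcM normcX w1 expr1n mul1r.
    exact: le_trans zp qr.
  have zp0 : z - p != 0 by rewrite -normc_gt0 zp.
  have [|k uk] := wc ((q - p) / (z - p)).
    by rewrite normcM normcV zp divff// lt0r_neq0.
  rewrite /g (bigD1 k)//= hq ?mul0r//.
  rewrite (_ : _ - q = (w ^+ k - (q - p) / (z - p)) * (z - p)).
    by move: uk; rewrite ltr_pdivlMr// normcM zp (normcBC (w ^+ k)).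
  by rewrite mulrBl divfK//; ring.
rewrite /g; under eq_bigr do rewrite subrr mulr0 addr0.
by rewrite prodr_const => /eqP; rewrite expf_eq0 => /andP[_ /eqP].
Qed.

End ArcUniqueness.

(** * The identity theorem *)

Section IdentityTheorem.
Variable R : realType.
Implicit Types (h : R[i] -> R[i]) (z w p : R[i]).

Lemma open_complex (D : set (R * R)) (q : R * R) : open D -> D q ->
  exists2 d : R, 0 < d &
    forall z, normc (z - (q.1 +i* q.2)) < d -> D (complex.Re z, complex.Im z).
Proof.
move=> oD /oD; rewrite -nbhs_ballE => -[d /= d0 dD]; exists d => // z zq.
apply: dD; split => /=; rewrite /ball/= distrC; apply: le_lt_trans zq.
  by have := normRe_le (z - (q.1 +i* q.2)); case: z.
by have := normIm_le (z - (q.1 +i* q.2)); case: z.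
Qed.

(* On the real axis [h] vanishes, hence so does its derivative. *)
Lemma strict_derivable_upper h p (d : R) : 0 < d ->
  (forall z, normc (z - p) < d -> complex.Im z = 0 -> h z = 0) ->
  strict_derivable h p ->
  strict_derivable (fun z => if 0 < complex.Im z then h z else 0) p.
Proof.
move=> d0 h0 [a D].
(* Off the real axis the sign of [Im z] is constant near [p], so the glued function is locally [h]
   or 0. *)
have near_const b : (forall z, normc (z - p) < `|complex.Im p| ->
    (0 < complex.Im z) = b) -> complex.Im p != 0 ->
    strict_derivable (fun z => if 0 < complex.Im z then h z else 0) p.
  move=> hb p0; have p0' : 0 < `|complex.Im p| by rewrite normr_gt0.
  case: b hb => hb.
    exists a => e /D[d' d'0 hd]; exists (Num.min d' `|complex.Im p|).
      by rewrite lt_min d'0.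
    by move=> z w; rewrite !lt_min => /andP[zd /hb->] /andP[wd /hb->]; exact: hd.
  exists 0 => e e0; exists `|complex.Im p| => // z w /hb-> /hb->.
  by rewrite subrr sub0r mul0r oppr0 normc0 mulr_ge0 ?normc_ge0 ?ltW.
have Im_le z : `|complex.Im z - complex.Im p| <= normc (z - p).
  by have := normIm_le (z - p); case: z p {h0 D near_const} => [? ?] [? ?].
have [p0|p0|p0] := ltgtP (complex.Im p) 0.
- apply: (near_const false); last by rewrite lt_eqF.
  move=> z zp; have := le_lt_trans (Im_le z) zp.
  rewrite (ltr0_norm p0) ltr_norml => /andP[_ ?].
  by apply/negbTE; rewrite -leNgt; lra.
- apply: (near_const true); last by rewrite gt_eqF.
  move=> z zp; have := le_lt_trans (Im_le z) zp.
  by rewrite (gtr0_norm p0) ltr_norml => /andP[? _]; lra.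
(* Here [p] is real, so projecting to the real axis does not increase the distance to [p]. *)
have proj_le z : normc (complex.Re z +i* 0 - p) <= normc (z - p).
  rewrite -(@ler_pXn2r _ 2)// ?nnegrE ?normc_ge0// !normc_sqr.
  move: p0; case: z (p) => [x y] [x' y'] /= ->.
  by rewrite subrr expr0n addr0 lerDl sqr_ge0.
(* Comparison of [p] with the real point [p + s]: [h] vanishes at both. *)
have a0 : a = 0.
  apply: eq0_normc; apply/eqP; rewrite eq_le normc_ge0 andbT.
  apply/ler_addgt0Pl => e e0; rewrite addr0.
  have [d' d'0 hd] := D _ e0; pose s := Num.min d d' / 2.
  have s0 : 0 < s by rewrite divr_gt0// lt_min d0.
  have [sd sd'] : s < d /\ s < d'.
    have : s < Num.min d d'.
      by rewrite ltr_pdivrMr// ltr_pMr ?ltr1n// lt_min d0.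
    by rewrite lt_min => /andP[].
  have ps : p + s%:C - p = s%:C by rewrite addrAC subrr add0r.
  have := hd p (p + s%:C); rewrite ps subrr normc0 normc_real gtr0_norm//.
  rewrite !h0 ?ps ?normc_real ?gtr0_norm ?subrr ?normc0//; last first.
    by move: p0; case: (p) => x y /= ->; rewrite addr0.
  rewrite sub0r normc_opp normcM normc_real gtr0_norm// ler_pM2r//.
  exact.
exists 0 => e e0; move: D; rewrite a0 => /(_ _ e0)[d' d'0 hd].
exists (Num.min d d'); first by rewrite lt_min d0.
(* For [z] above the axis and [w] not above it, [h z] is compared with the value 0 of [h] at the
   projection of [z]. The height of [z] is at most [normc (w - z)]. *)
have above z w : normc (z - p) < Num.min d d' -> normc (w - p) < Num.min d d' ->
    0 < complex.Im z -> complex.Im w <= 0 -> normc (h z) <= e * normc (w - z).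
  rewrite !lt_min => /andP[zd zd'] /andP[wd wd'] z0 w0.
  have := hd (complex.Re z +i* 0) z (le_lt_trans (proj_le z) zd') zd'.
  rewrite (h0 (_ +i* _)) ?mul0r ?subr0 => [le_hz||]; last 2 first.
  - exact: le_lt_trans (proj_le z) zd.
  - by [].
  apply: le_trans le_hz _; rewrite ler_pM2l//.
  rewrite -(@ler_pXn2r _ 2)// ?nnegrE ?normc_ge0// !normc_sqr.
  move: z0 w0; case: (z) (w) => [x y] [x' y'] /= y0 y'0.
  rewrite subrr expr0n add0r subr0 -subr_ge0.
  rewrite (_ : _ - _ = (x' - x) ^+ 2 + y' ^+ 2 + 2 * (y * - y')); last by ring.
  by rewrite !addr_ge0 ?sqr_ge0// !mulr_ge0 ?oppr_ge0// ltW.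
move=> z w zp wp; rewrite mul0r subr0.
case: ltP => w0; case: ltP => z0.
- have := hd z w; rewrite mul0r subr0; move: zp wp; rewrite !lt_min.
  by move=> /andP[_ ?] /andP[_ ?]; exact.
- by rewrite subr0 (normcBC w); exact: above.
- by rewrite sub0r normc_opp; exact: above.
- by rewrite subrr normc0 mulr_ge0 ?normc_ge0 ?ltW.
Qed.

Lemma identity_theorem (D : set (R * R)) h (x0 : R) :
  open D -> connected D ->
  (forall q, D q -> strict_derivable h (q.1 +i* q.2)) ->
  D (x0, 0) -> (forall x : R, D (x, 0) -> h (x +i* 0) = 0) ->
  forall q, D q -> h (q.1 +i* q.2) = 0.
Proof.
move=> oD cD hD Dx0 hx.
(* The part of [Z] in [D] is shown to be nonempty, relatively open and relatively closed. *)
pose Z := [set q : R * R | exists2 d : R, 0 < d &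
  forall z, normc (z - (q.1 +i* q.2)) < d -> h z = 0].
suff DZ : D `&` Z = D.
  by move=> q; rewrite -{1}DZ => -[_ [d d0]]; apply; rewrite subrr normc0.
apply: cD.
- have [d d0 dD] := open_complex oD Dx0.
  have hd z : normc (z - (x0 +i* 0)) < d -> strict_derivable h z.
    by move=> /dD/hD; case: z.
  pose g z := if 0 < complex.Im z then h z else 0.
  have gD z : normc (z - (x0 +i* 0)) < d -> strict_derivable g z.
    move=> zd; pose d' := d - normc (z - (x0 +i* 0)).
    apply: (@strict_derivable_upper _ _ d'); rewrite /d'.
    + by rewrite subr_gt0.
    + move=> w wz w0; have : normc (w - (x0 +i* 0)) < d.
        by have := normc_triangle z w (x0 +i* 0); lra.
      by move/dD; move: w0; case: (w) => x y /= -> /hx.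
    + exact: hd.
  have d4 : 0 < d / 4 by rewrite divr_gt0.
  (* The disc of radius [d / 4] about [q0] lies below the real axis, where [g] is 0. If [z] is
     within [d / 4] of [x0], the disc of radius [d / 2] about [z] contains [q0] and stays within [d]
     of [x0]. *)
  pose q0 : R[i] := x0 +i* (- (d / 4)).
  have q0x0 : normc (q0 - (x0 +i* 0)) <= d / 4.
    apply: le_trans (normc_le_ReIm _) _ => /=.
    by rewrite subrr normr0 add0r subr0 normrN gtr0_norm.
  have g0 z : normc (z - (x0 +i* 0)) < d / 4 -> g z = 0.
    move=> zd; apply: (@arc_zero _ _ _ q0 (d / 2) (d / 4)) => //.
    + have := normc_triangle (x0 +i* 0) q0 z.
      by rewrite (normcBC (x0 +i* 0)); lra.
    + move=> w wz; apply: gD; have := normc_triangle z w (x0 +i* 0); lra.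
    + move=> w wq; rewrite /g ltNge.
      have : `|complex.Im w - - (d / 4)| <= normc (w - q0).
        by have := normIm_le (w - q0); case: (w).
      rewrite ler_norml => /andP[_ ?]; rewrite (_ : _ <= 0)//; lra.
  (* The disc of radius [d / 8] about [p0] lies above the real axis, where [g] is [h], and within
     [d / 4] of [x0]. *)
  pose p0 := (x0, d / 8); have d8 : 0 < d / 8 by rewrite divr_gt0.
  have p0x0 : normc (p0.1 +i* p0.2 - (x0 +i* 0)) <= d / 8.
    apply: le_trans (normc_le_ReIm _) _ => /=.
    by rewrite subrr normr0 add0r subr0 gtr0_norm.
  exists p0; split.
    have := dD (p0.1 +i* p0.2); apply; lra.
  exists (d / 8) => // z zp0.
  have := g0 z; rewrite /g.
  have : `|complex.Im z - d / 8| <= normc (z - (p0.1 +i* p0.2)).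
    by have := normIm_le (z - (p0.1 +i* p0.2)); case: (z).
  rewrite ler_norml => /andP[zIm _]; rewrite (_ : 0 < _); last by lra.
  apply; have := normc_triangle (p0.1 +i* p0.2) z (x0 +i* 0); lra.
- exists Z => //; rewrite openE => q [d d0 hq].
  have d2 : 0 < d / 2 by rewrite divr_gt0.
  have := near_complex q d2; apply: filterS => q' q'q.
  exists (d / 2) => // z zq'; apply: hq.
  have := normc_triangle (q'.1 +i* q'.2) z (q.1 +i* q.2); lra.
- exists (closure Z); first exact: closed_closure.
  apply/seteqP; split => q [Dq Zq]; split => //; first exact: subset_closure.
  have [d d0 dD] := open_complex oD Dq.
  have d4 : 0 < d / 4 by rewrite divr_gt0.
  (* If [z] is within [d / 4] of [q], then [q'] is within [d / 2] of [z], and the disc of radius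
     [d / 2] about [z] stays within [d] of [q]. *)
  have [q' [[d' d'0 hq'] q'q]] := Zq _ (near_complex q d4).
  exists (d / 4) => // z zq.
  apply: (@arc_zero _ _ _ (q'.1 +i* q'.2) (d / 2) d') => //.
    have := normc_triangle (q.1 +i* q.2) (q'.1 +i* q'.2) z.
    rewrite (normcBC (q.1 +i* q.2)) => le1.
    by apply: le_trans le1 _; move: q'q => /=; lra.
  move=> w wz; have : normc (w - (q.1 +i* q.2)) < d.
    have := normc_triangle z w (q.1 +i* q.2); lra.
  by move=> /dD/hD; case: (w).
Qed.

End IdentityTheorem.

(** * Strict differentiability of C^1 maps of the plane *)

Section RealStrictDifferentiability.
Variable R : realType.

Lemma mean_value_linear_bound (g dg : R -> R) (c d a e : R) :
  (forall t, `|t - c| < d -> is_derive t 1 g (dg t) /\ `|dg t - a| <= e) ->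
  forall s t, `|s - c| < d -> `|t - c| < d ->
    `|g t - g s - (t - s) * a| <= e * `|t - s|.
Proof.
move=> gD s t; wlog st : s t / s <= t => [th|] sc tc.
  have [st|ts] := leP s t; first exact: th.
  rewrite (distrC t) (_ : g t - g s - (t - s) * a = - (g s - g t - (s - t) * a)).
    by rewrite normrN; apply: th => //; exact: ltW.
  by ring.
have inD x : x \in `[s, t] -> `|x - c| < d.
  move: sc tc; rewrite in_itv/= !ltr_norml => /andP[? ?] /andP[? ?] /andP[? ?].
  by apply/andP; split; lra.
have gd x : x \in `]s, t[ -> is_derive x 1 g (dg x).
  by move=> /subset_itv_oo_cc/inD/gD[].
have cg : {within `[s, t], continuous g}.
  by apply: derivable_within_continuous => x /inD/gD[[]].
have [x /inD/gD[_ xa] ->] := MVT_segment st gd cg.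
by rewrite (mulrC (dg x)) -mulrBr normrM mulrC ler_wpM2r.
Qed.

Lemma norm_rV_le n (v : 'rV[R]_n) (c : R) : 0 <= c ->
  (forall k, `|v 0 k| <= c) -> `|v| <= c.
Proof.
move=> c0 vc; rewrite /Num.norm/= mx_normrE; apply: bigmax_le => // -[i j] _ /=.
by rewrite (ord1 i).
Qed.

Lemma norm_coord_le n (v : 'rV[R]_n) k : `|v 0 k| <= `|v|.
Proof.
by rewrite [leRHS]/Num.norm/= mx_normrE; exact: (le_bigmax _ _ (ord0, k)).
Qed.

(* [R ^ 2] is represented by [R[i]], with the Euclidean norm [normc]. *)
Definition real_strict_derive n (phi : R[i] -> 'rV[R]_n) (a b : 'rV[R]_n)
    (p : R[i]) := forall e : R, 0 < e -> exists2 d : R, 0 < d &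
  forall z w, normc (z - p) < d -> normc (w - p) < d ->
    `|phi w - phi z - (complex.Re (w - z) *: a + complex.Im (w - z) *: b)|
      <= e * normc (w - z).

(** The increment from [z] to [w] is taken through the corner with the abscissa of [z] and the
    ordinate of [w]. On each leg the mean value theorem, applied to one coordinate at a time, costs
    [e / 2]. *)
Lemma C1_real_strict_derive n (phi : R -> R -> 'rV[R]_n) (D : set (R * R)) x y
    (dx dy : R * R -> 'rV[R]_n) : open D -> D (x, y) ->
  (forall q, D q ->
    [/\ derivable (phi^~ q.2) q.1 1, derivable (phi q.1) q.2 1,
        dx q = derive1 (phi^~ q.2) q.1 & dy q = derive1 (phi q.1) q.2]) ->
  {for (x, y), continuous dx} -> {for (x, y), continuous dy} ->
  real_strict_derive (fun z => phi (complex.Re z) (complex.Im z))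
    (dx (x, y)) (dy (x, y)) (x +i* y).
Proof.
move=> oD Dxy phiD cdx cdy e e0; have e2 : 0 < e / 2 by rewrite divr_gt0.
have : nbhs ((x, y) : R * R) (D `&` ([set q | `|dx (x, y) - dx q| <= e / 2] `&`
      [set q | `|dy (x, y) - dy q| <= e / 2])).
  apply: filterI; first exact: oD.
  by apply: filterI; [move/cvgrPdist_le : cdx|move/cvgrPdist_le : cdy]; exact.
rewrite -nbhs_ballE => -[d /= d0 hd]; exists d => // z w zd wd.
have box (x' y' : R) : `|x' - x| < d -> `|y' - y| < d ->
    [/\ D (x', y'), `|dx (x, y) - dx (x', y')| <= e / 2 &
        `|dy (x, y) - dy (x', y')| <= e / 2].
  move=> xd yd; have [] : (D `&` ([set q | `|dx (x, y) - dx q| <= e / 2] `&`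
      [set q | `|dy (x, y) - dy q| <= e / 2])) (x', y').
    by apply: hd; split; rewrite /ball /= distrC.
  by move=> ? [].
have [z1 z2] : `|complex.Re z - x| < d /\ `|complex.Im z - y| < d.
  by have := (normRe_le (z - (x +i* y)), normIm_le (z - (x +i* y)));
     case: (z) zd => ? ? /= zd [? ?]; split; apply: le_lt_trans zd.
have [w1 w2] : `|complex.Re w - x| < d /\ `|complex.Im w - y| < d.
  by have := (normRe_le (w - (x +i* y)), normIm_le (w - (x +i* y)));
     case: (w) wd => ? ? /= wd [? ?]; split; apply: le_lt_trans wd.
have -> : complex.Re (w - z) = complex.Re w - complex.Re z.
  by case: (w) (z) => ? ? [].
have -> : complex.Im (w - z) = complex.Im w - complex.Im z.
  by case: (w) (z) => ? ? [].
have wz1 : `|complex.Re w - complex.Re z| <= normc (w - z).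
  by have := normRe_le (w - z); case: (w) (z) => ? ? [].
have wz2 : `|complex.Im w - complex.Im z| <= normc (w - z).
  by have := normIm_le (w - z); case: (w) (z) => ? ? [].
move: (complex.Re w) (complex.Im w) (complex.Re z) (complex.Im z)
  z1 z2 w1 w2 wz1 wz2 => x2 y2 x1 y1 z1 z2 w1 w2 wz1 wz2.
apply: norm_rV_le => [|k]; first by rewrite mulr_ge0 ?normc_ge0// ltW.
rewrite !mxE.
have X : `|phi x2 y2 0 k - phi x1 y2 0 k - (x2 - x1) * dx (x, y) 0 k| <=
    e / 2 * `|x2 - x1|.
  apply: (@mean_value_linear_bound (fun t => phi t y2 0 k)
    (fun t => dx (t, y2) 0 k) x d) => // t td.
  have [Dt te _] := box _ _ td w2; have [/= Dx _ dxE _] := phiD _ Dt; split.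
    rewrite dxE derive1E derive_mx// mxE; apply: derivableP.
    by have /derivable_mxP := Dx; exact.
  apply: le_trans te; rewrite distrC.
  by have := norm_coord_le (dx (x, y) - dx (t, y2)) k; rewrite !mxE.
have Y : `|phi x1 y2 0 k - phi x1 y1 0 k - (y2 - y1) * dy (x, y) 0 k| <=
    e / 2 * `|y2 - y1|.
  apply: (@mean_value_linear_bound (fun t => phi x1 t 0 k)
    (fun t => dy (x1, t) 0 k) y d) => // t td.
  have [Dt _ te] := box _ _ z1 td; have [/= _ Dy _ dyE] := phiD _ Dt; split.
    rewrite dyE derive1E derive_mx// mxE; apply: derivableP.
    by have /derivable_mxP := Dy; exact.
  apply: le_trans te; rewrite distrC.
  by have := norm_coord_le (dy (x, y) - dy (x1, t)) k; rewrite !mxE.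
rewrite (_ : _ - _ = (phi x2 y2 0 k - phi x1 y2 0 k - (x2 - x1) * dx (x, y) 0 k) +
  (phi x1 y2 0 k - phi x1 y1 0 k - (y2 - y1) * dy (x, y) 0 k)); last by ring.
apply: le_trans (ler_normD _ _) _; apply: le_trans (lerD X Y) _.
by rewrite -mulrDr -mulrA ler_wpM2l ?(ltW e0)//; lra.
Qed.

Lemma real_strict_deriveD n (phi psi : R[i] -> 'rV[R]_n) a b c d p :
  real_strict_derive phi a b p -> real_strict_derive psi c d p ->
  real_strict_derive (fun z => phi z + psi z) (a + c) (b + d) p.
Proof.
move=> D1 D2 e e0; have e2 : 0 < e / 2 by rewrite divr_gt0.
have [d1 d10 h1] := D1 _ e2; have [d2 d20 h2] := D2 _ e2.
exists (Num.min d1 d2); first by rewrite lt_min d10.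
move=> z w; rewrite !lt_min => /andP[z1 z2] /andP[w1 w2].
rewrite (_ : _ - _ =
    (phi w - phi z - (complex.Re (w - z) *: a + complex.Im (w - z) *: b)) +
    (psi w - psi z - (complex.Re (w - z) *: c + complex.Im (w - z) *: d))).
  apply: le_trans (ler_normD _ _) _.
  apply: le_trans (lerD (h1 _ _ z1 w1) (h2 _ _ z2 w2)) _.
  by rewrite -mulrDl -splitr.
by apply/rowP => k; rewrite !mxE; ring.
Qed.

Lemma linear_rV_bound m n (L : {linear 'rV[R]_m -> 'rV[R]_n}) :
  exists2 K : R, 0 < K & forall v, `|L v| <= K * `|v|.
Proof.
exists (1 + \sum_i `|L (delta_mx 0 i)|).
  by apply: ltr_pwDl => //; apply: sumr_ge0.
move=> v; rewrite {1}(row_sum_delta v) linear_sum.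
apply: le_trans (ler_norm_sum _ _ _) _.
apply: (@le_trans _ _ ((\sum_i `|L (delta_mx 0 i)|) * `|v|)).
  2: by rewrite ler_wpM2r// lerDr.
rewrite mulr_suml; apply: ler_sum => i _; rewrite linearZ normrZ mulrC ler_wpM2l//.
exact: norm_coord_le.
Qed.

Lemma real_strict_derive_linear m n (L : {linear 'rV[R]_m -> 'rV[R]_n}) phi a b p :
  real_strict_derive phi a b p ->
  real_strict_derive (L \o phi) (L a) (L b) p.
Proof.
have [K K0 LK] := linear_rV_bound L; move=> D e e0.
have [d d0 hd] := D _ (divr_gt0 e0 K0); exists d => // z w zp wp /=.
rewrite -!linearZ -linearD -!linearB; apply: le_trans (LK _) _.
by rewrite -ler_pdivlMl// mulrA (mulrC K^-1); exact: hd.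
Qed.

End RealStrictDifferentiability.

(** * Octonions in coordinates *)

Section OctonionCoordinates.
Variable R : realType.
Implicit Types z u v I : octonion R.

(** The nesting of blocks follows the three doublings, so that the projections in [cd_mul] and
    [cd_conj] reduce by rewriting. *)
Definition ovec (x0 x1 x2 x3 x4 x5 x6 x7 : R) : octonion R :=
  row_mx (row_mx (row_mx x0%:M x1%:M) (row_mx x2%:M x3%:M))
         (row_mx (row_mx x4%:M x5%:M) (row_mx x6%:M x7%:M))
    : 'rV[R]_(((1 + 1) + (1 + 1)) + ((1 + 1) + (1 + 1))).

Lemma ovecP z :
  exists x0 x1 x2 x3 x4 x5 x6 x7, z = ovec x0 x1 x2 x3 x4 x5 x6 x7.
Proof.
pose z' := z : 'rV[R]_(((1 + 1) + (1 + 1)) + ((1 + 1) + (1 + 1))).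
have E (u : 'rV[R]_(1 + 1)) :
    u = row_mx (u 0 (lshift 1 0))%:M (u 0 (rshift 1 0))%:M.
  by rewrite -[LHS]hsubmxK; congr row_mx; rewrite [LHS]mx11_scalar !mxE.
pose l := @lsubmx _ _ 4 4 z'; pose r := @rsubmx _ _ 4 4 z'.
have -> : z = row_mx
    (row_mx (@lsubmx _ _ 2 2 l) (@rsubmx _ _ 2 2 l))
    (row_mx (@lsubmx _ _ 2 2 r) (@rsubmx _ _ 2 2 r)) by rewrite !hsubmxK.
rewrite (E (@lsubmx _ _ 2 2 l)) (E (@rsubmx _ _ 2 2 l)).
rewrite (E (@lsubmx _ _ 2 2 r)) (E (@rsubmx _ _ 2 2 r)).
by do 8 eexists.
Qed.

Let scalar_mx1D (a b : R) : a%:M + b%:M = (a + b)%:M :> 'M[R]_1.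
Proof. by rewrite raddfD. Qed.

Let scalar_mx1N (a : R) : - a%:M = (- a)%:M :> 'M[R]_1.
Proof. by rewrite raddfN. Qed.

Let scalar_mx1M (a b : R) : a%:M *m b%:M = (a * b)%:M :> 'M[R]_1.
Proof. by rewrite scalar_mxM. Qed.

Lemma oconj_ovec x0 x1 x2 x3 x4 x5 x6 x7 :
  oconj (ovec x0 x1 x2 x3 x4 x5 x6 x7) =
  ovec x0 (- x1) (- x2) (- x3) (- x4) (- x5) (- x6) (- x7).
Proof.
rewrite /oconj /ovec /=.
by rewrite !(row_mxKl, row_mxKr, opp_row_mx, scalar_mx1N).
Qed.

(** The multiplication table. It turns octonion identities into real polynomial ones, so that
    non-associativity needs no special care. *)
Lemma omul_ovec x0 x1 x2 x3 x4 x5 x6 x7 y0 y1 y2 y3 y4 y5 y6 y7 :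
  omul (ovec x0 x1 x2 x3 x4 x5 x6 x7) (ovec y0 y1 y2 y3 y4 y5 y6 y7) =
  ovec
        (x0 * y0 - x1 * y1 - x2 * y2 - x3 * y3 - x4 * y4 - x5 * y5 - x6 * y6 -
     x7 * y7)
        (x0 * y1 + x1 * y0 + x2 * y3 - x3 * y2 + x4 * y5 - x5 * y4 - x6 * y7 +
     x7 * y6)
        (x0 * y2 - x1 * y3 + x2 * y0 + x3 * y1 + x4 * y6 + x5 * y7 - x6 * y4 -
     x7 * y5)
        (x0 * y3 + x1 * y2 - x2 * y1 + x3 * y0 + x4 * y7 - x5 * y6 + x6 * y5 -
     x7 * y4)
        (x0 * y4 - x1 * y5 - x2 * y6 - x3 * y7 + x4 * y0 + x5 * y1 + x6 * y2 +
     x7 * y3)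
        (x0 * y5 + x1 * y4 - x2 * y7 + x3 * y6 - x4 * y1 + x5 * y0 - x6 * y3 +
     x7 * y2)
        (x0 * y6 + x1 * y7 + x2 * y4 - x3 * y5 - x4 * y2 + x5 * y3 + x6 * y0 -
     x7 * y1)
        (x0 * y7 - x1 * y6 + x2 * y5 + x3 * y4 - x4 * y3 - x5 * y2 + x6 * y1 +
     x7 * y0).
Proof.
rewrite /omul /ovec /= !(row_mxKl, row_mxKr, opp_row_mx, add_row_mx).
rewrite !(scalar_mx1M, scalar_mx1N, scalar_mx1D).
by congr (row_mx (row_mx (row_mx _%:M _%:M) (row_mx _%:M _%:M))
  (row_mx (row_mx _%:M _%:M) (row_mx _%:M _%:M))); ring.
Qed.

Lemma ovecD x0 x1 x2 x3 x4 x5 x6 x7 y0 y1 y2 y3 y4 y5 y6 y7 :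
  ovec x0 x1 x2 x3 x4 x5 x6 x7 + ovec y0 y1 y2 y3 y4 y5 y6 y7 =
  ovec (x0 + y0) (x1 + y1) (x2 + y2) (x3 + y3)
       (x4 + y4) (x5 + y5) (x6 + y6) (x7 + y7).
Proof.
by rewrite /ovec (@add_row_mx _ 1 (1 + 1 + (1 + 1)) (1 + 1 + (1 + 1)))
  !add_row_mx !scalar_mx1D.
Qed.

Lemma ovecZ a x0 x1 x2 x3 x4 x5 x6 x7 :
  a *: ovec x0 x1 x2 x3 x4 x5 x6 x7 =
  ovec (a * x0) (a * x1) (a * x2) (a * x3) (a * x4) (a * x5) (a * x6) (a * x7).
Proof.
by rewrite /ovec (@scale_row_mx _ 1 (1 + 1 + (1 + 1)) (1 + 1 + (1 + 1)))
  !scale_row_mx !scale_scalar_mx.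
Qed.

Lemma ovecN x0 x1 x2 x3 x4 x5 x6 x7 :
  - ovec x0 x1 x2 x3 x4 x5 x6 x7 =
  ovec (- x0) (- x1) (- x2) (- x3) (- x4) (- x5) (- x6) (- x7).
Proof.
by rewrite /ovec (@opp_row_mx _ 1 (1 + 1 + (1 + 1)) (1 + 1 + (1 + 1)))
  !opp_row_mx !scalar_mx1N.
Qed.

Let scalar_mx1_inj (a b : R) : a%:M = b%:M :> 'M[R]_1 -> a = b.
Proof. by move=> /matrixP/(_ 0 0); rewrite !mxE eqxx. Qed.

Lemma ovec_inj x0 x1 x2 x3 x4 x5 x6 x7 y0 y1 y2 y3 y4 y5 y6 y7 :
  ovec x0 x1 x2 x3 x4 x5 x6 x7 = ovec y0 y1 y2 y3 y4 y5 y6 y7 ->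
  [/\ x0 = y0, x1 = y1, x2 = y2 & x3 = y3] /\
  [/\ x4 = y4, x5 = y5, x6 = y6 & x7 = y7].
Proof.
move=> /(@eq_row_mx _ 1 ((1 + 1) + (1 + 1)) ((1 + 1) + (1 + 1)))[].
move=> /eq_row_mx[/eq_row_mx[e0 e1] /eq_row_mx[e2 e3]].
move=> /eq_row_mx[/eq_row_mx[e4 e5] /eq_row_mx[e6 e7]].
by split; split; exact: scalar_mx1_inj.
Qed.

Let ord0_lshift : (0 : 'I_8) = lshift 4 (lshift 2 (lshift 1 (0 : 'I_1))).
Proof. exact: val_inj. Qed.

Lemma oone_ovec : oone = ovec 1 0 0 0 0 0 0 0.
Proof.
rewrite /oone ord0_lshift (@delta_mx_lshift _ 1 4 4) (@delta_mx_lshift _ 1 2 2).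
rewrite (@delta_mx_lshift _ 1 1 1) /ovec !raddf0 !row_mx0.
rewrite (_ : delta_mx 0 0 = 1%:M)//.
by apply/matrixP => i j; rewrite !mxE !ord1.
Qed.

Lemma oRe_ovec x0 x1 x2 x3 x4 x5 x6 x7 : oRe (ovec x0 x1 x2 x3 x4 x5 x6 x7) = x0.
Proof.
rewrite /oRe ord0_lshift /ovec (@row_mxEl _ 1 4 4) (@row_mxEl _ 1 2 2).
by rewrite (@row_mxEl _ 1 1 1) mxE eqxx.
Qed.

Definition ovecE := (omul_ovec, oconj_ovec, ovecD, ovecZ, ovecN, oone_ovec).

Lemma oinner_ovec x0 x1 x2 x3 x4 x5 x6 x7 y0 y1 y2 y3 y4 y5 y6 y7 :
  oinner (ovec x0 x1 x2 x3 x4 x5 x6 x7) (ovec y0 y1 y2 y3 y4 y5 y6 y7) =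
  x0 * y0 + x1 * y1 + x2 * y2 + x3 * y3 + x4 * y4 + x5 * y5 + x6 * y6 + x7 * y7.
Proof. by rewrite /oinner !ovecE oRe_ovec; ring. Qed.

Lemma onorm_sqr z : onorm z ^+ 2 = oinner z z.
Proof.
rewrite sqr_sqrtr//; have [x0 [x1 [x2 [x3 [x4 [x5 [x6 [x7 ->]]]]]]]] := ovecP z.
by rewrite oinner_ovec -!expr2 !addr_ge0 ?sqr_ge0.
Qed.

Lemma omul_is_linear z : linear (omul z).
Proof.
move=> a u v.
have [x0 [x1 [x2 [x3 [x4 [x5 [x6 [x7 ->]]]]]]]] := ovecP z.
have [u0 [u1 [u2 [u3 [u4 [u5 [u6 [u7 ->]]]]]]]] := ovecP u.
have [v0 [v1 [v2 [v3 [v4 [v5 [v6 [v7 ->]]]]]]]] := ovecP v.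
by rewrite !ovecE; congr ovec; ring.
Qed.

End OctonionCoordinates.

Local Arguments omul : simpl never.

Definition omul_linear (R : realType) (z : octonion R) :
    {linear octonion R -> octonion R} :=
  HB.pack (omul z)
    (GRing.isLinear.Build R (octonion R) (octonion R) *:%R (omul z)
      (omul_is_linear z)).

(** * Imaginary units and their left multiplications *)

Section ImaginaryUnits.
Variable R : realType.
Implicit Types z v I J : octonion R.

Lemma omulZr z a v : omul z (a *: v) = a *: omul z v.
Proof. exact: (linearZZ (omul_linear z)). Qed.

Lemma omulr0 z : omul z 0 = 0.
Proof. exact: (linear0 (omul_linear z)). Qed.

Lemma oimag_ovec I : oimag I -> exists x1 x2 x3 x4 x5 x6 x7,
  I = ovec 0 x1 x2 x3 x4 x5 x6 x7 /\
  x1 ^+ 2 + x2 ^+ 2 + x3 ^+ 2 + x4 ^+ 2 + x5 ^+ 2 + x6 ^+ 2 + x7 ^+ 2 = 1.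
Proof.
rewrite /oimag /=; have [x0 [x1 [x2 [x3 [x4 [x5 [x6 [x7 ->]]]]]]]] := ovecP I.
rewrite !ovecE => /ovec_inj[[e0 e1 e2 e3] [e4 e5 e6 e7]].
(* The imaginary coordinates of the square are the [2 * (x0 * xi)]. If [x0] were nonzero, all [xi]
   would vanish and [x0 ^ 2] would be -1. *)
have pure x : 2 * (x0 * x) = 0 -> x0 * x = 0.
  by move/eqP; rewrite mulf_eq0 pnatr_eq0 => /eqP.
have x00 : x0 = 0.
  have [//|x0_neq0] := eqVneq x0 0.
  have zero x : 2 * (x0 * x) = 0 -> x = 0.
    by move/pure/eqP; rewrite mulf_eq0 (negPf x0_neq0) => /eqP.
  have z1 : x1 = 0 by apply: zero; lra.
  have z2 : x2 = 0 by apply: zero; lra.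
  have z3 : x3 = 0 by apply: zero; lra.
  have z4 : x4 = 0 by apply: zero; lra.
  have z5 : x5 = 0 by apply: zero; lra.
  have z6 : x6 = 0 by apply: zero; lra.
  have z7 : x7 = 0 by apply: zero; lra.
  by move: e0; rewrite z1 z2 z3 z4 z5 z6 z7; nra.
exists x1, x2, x3, x4, x5, x6, x7.
by split; [rewrite x00|move: e0; rewrite x00; lra].
Qed.

Lemma oimagN I : oimag I -> oimag (- I).
Proof.
rewrite /oimag /= => <-.
have [x0 [x1 [x2 [x3 [x4 [x5 [x6 [x7 ->]]]]]]]] := ovecP I.
by rewrite !ovecE; congr ovec; ring.
Qed.

Lemma omulNl I v : omul (- I) v = - omul I v.
Proof.
have [x0 [x1 [x2 [x3 [x4 [x5 [x6 [x7 ->]]]]]]]] := ovecP I.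
have [v0 [v1 [v2 [v3 [v4 [v5 [v6 [v7 ->]]]]]]]] := ovecP v.
by rewrite !ovecE; congr ovec; ring.
Qed.

(** An instance of alternativity: left multiplication by [I] is a complex structure. Writing 1 as
    the sum of the squared coordinates of [I] leaves polynomial identities. *)
Lemma omul_imagK I v : oimag I -> omul I (omul I v) = - v.
Proof.
move=> /oimag_ovec[x1 [x2 [x3 [x4 [x5 [x6 [x7 [-> x1E]]]]]]]].
have [v0 [v1 [v2 [v3 [v4 [v5 [v6 [v7 ->]]]]]]]] := ovecP v.
rewrite -scaleN1r -x1E !ovecE; congr ovec; ring.
Qed.

Lemma omul_opoint I a b : oimag I -> omul I (opoint I a b) = opoint I (- b) a.
Proof.
move=> /oimag_ovec[x1 [x2 [x3 [x4 [x5 [x6 [x7 [-> x1E]]]]]]]].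
rewrite /opoint -[- b]mulr1 -x1E !ovecE; congr ovec; ring.
Qed.

(** In the cross term, 1 is orthogonal to [J] and [I] is orthogonal to [J I], while the inner
    product of 1 with [J I] is the opposite of that of [I] with [J]. *)
Lemma onorm_opoint_sum I J p q r s : oimag I -> oimag J ->
  onorm (opoint I p q + omul J (opoint I r s)) ^+ 2 =
  p ^+ 2 + q ^+ 2 + r ^+ 2 + s ^+ 2 + 2 * (q * r - p * s) * oinner I J.
Proof.
move=> /oimag_ovec[x1 [x2 [x3 [x4 [x5 [x6 [x7 [-> x1E]]]]]]]].
move=> /oimag_ovec[y1 [y2 [y3 [y4 [y5 [y6 [y7 [-> y1E]]]]]]]].
rewrite onorm_sqr /opoint !ovecE !oinner_ovec.
(* The squared norms of [I] and [J] are kept as sums of squares until [ring] has done the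
   expansion. *)
transitivity (p ^+ 2 +
    q ^+ 2 * (x1 ^+ 2 + x2 ^+ 2 + x3 ^+ 2 + x4 ^+ 2 + x5 ^+ 2 + x6 ^+ 2 + x7 ^+ 2) +
    (r ^+ 2 + s ^+ 2 *
      (x1 ^+ 2 + x2 ^+ 2 + x3 ^+ 2 + x4 ^+ 2 + x5 ^+ 2 + x6 ^+ 2 + x7 ^+ 2)) *
      (y1 ^+ 2 + y2 ^+ 2 + y3 ^+ 2 + y4 ^+ 2 + y5 ^+ 2 + y6 ^+ 2 + y7 ^+ 2) +
    2 * (q * r - p * s) * (0 * 0 + x1 * y1 + x2 * y2 + x3 * y3 + x4 * y4 +
      x5 * y5 + x6 * y6 + x7 * y7)); first by ring.
by rewrite x1E y1E; ring.
Qed.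

End ImaginaryUnits.

(** * The representation formula *)

Section SliceRegular.
Variable R : realType.
Implicit Types I J K : octonion R.

Lemma opoint0 I (x : R) : opoint I x 0 = x *: oone.
Proof. by rewrite /opoint scale0r addr0. Qed.

Lemma opointN I (x y : R) : opoint (- I) x y = opoint I x (- y).
Proof. by rewrite /opoint scalerN scaleNr. Qed.

Lemma continuous_opoint K : continuous (fun q : R * R => opoint K q.1 q.2).
Proof.
move=> q; have sc (v : octonion R) : continuous (fun t : R => t *: v).
  by move=> t; exact: scalel_continuous.
apply: cvgD.
  by apply: (@continuous_comp _ _ _ fst (fun t : R => t *: oone));
    [exact: cvg_fst|exact: sc].
by apply: (@continuous_comp _ _ _ snd (fun t : R => t *: K));
  [exact: cvg_snd|exact: sc].
Qed.

Lemma open_slice (Omega : set (octonion R)) K : open Omega ->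
  open [set q : R * R | Omega (opoint K q.1 q.2)].
Proof. by move=> oO; apply: open_comp => // q _; exact: continuous_opoint. Qed.

Lemma oimag_Re J : oimag J -> J 0 0 = 0.
Proof.
by move=> /oimag_ovec[? [? [? [? [? [? [? [-> _]]]]]]]]; exact: oRe_ovec.
Qed.

Lemma oimag_neq0 J : oimag J -> J != 0.
Proof.
rewrite /oimag /=; apply: contraPneq => ->; rewrite omulr0 => /eqP.
rewrite eq_sym oppr_eq0 => /eqP/matrixP/(_ 0 0)/eqP.
by rewrite !mxE !eqxx oner_eq0.
Qed.

(** The coordinates [x] and [y] are recovered continuously from [x + y J]: [x] is the real part, and
    [y] is read off at a coordinate [m] where [J] is nonzero. *)
Lemma connected_slice (Omega : set (octonion R)) J : oimag J ->
  connected (Omega `&` oslice J) ->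
  connected [set q : R * R | Omega (opoint J q.1 q.2)].
Proof.
move=> SJ cO; have [m Jm] : exists m, J 0 m != 0.
  have [k /= Jk|J0] := pickP (fun k => J 0 k != 0); first by exists k.
  have /eqP[] := oimag_neq0 SJ; apply/rowP => k; rewrite mxE.
  by have /negbFE/eqP := J0 k.
have m0 : m != 0 by apply: contraNneq Jm => ->; rewrite oimag_Re.
pose proj (v : octonion R) : R * R := (v 0 0, v 0 m / J 0 m).
have projK q : proj (opoint J q.1 q.2) = q.
  case: q => x y; rewrite /proj /opoint !mxE !eqxx (negPf m0) oimag_Re//.
  by rewrite mulr1 !mulr0 addr0 add0r mulfK.
rewrite (_ : [set q | _] = proj @` (Omega `&` oslice J)).
  apply: connected_continuous_connected => //; apply: continuous_subspaceT => v.
  have coord k : (fun u : octonion R => u 0 k) @ v --> v 0 k.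
    exact: coord_continuous.
  have coord_m : (fun u : octonion R => u 0 m / J 0 m) @ v --> v 0 m / J 0 m.
    exact: cvgM (coord m) (cvg_cst _).
  exact: cvg_pair (coord 0) coord_m.
apply/seteqP; split => [q /= Oq|_ [v [Ov [x [y vE]]] <-] /=].
  by exists (opoint J q.1 q.2) => //; split => //; exists q.1, q.2.
by have := projK (x, y); rewrite /= -vE => -[-> ->]; rewrite -vE.
Qed.

Section FixedFunction.
Variables (Omega : set (octonion R)) (f : octonion R -> octonion R).
Hypothesis reg : slice_regular Omega f.

Definition slice_fun K (z : R[i]) := f (opoint K (complex.Re z) (complex.Im z)).

Lemma slice_real_strict_derive K x y : oimag K -> Omega (opoint K x y) ->
  real_strict_derive (slice_fun K) (slice_dx f K (x, y)) (slice_dy f K (x, y))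
    (x +i* y).
Proof.
case: reg => -[_ oO _] fD SK Oxy; have [_ _ cx cy _] := fD K SK x y Oxy.
have phiD q : Omega (opoint K q.1 q.2) ->
    [/\ derivable (fun t => f (opoint K t q.2)) q.1 1,
        derivable (fun t => f (opoint K q.1 t)) q.2 1,
        slice_dx f K q = derive1 (fun t => f (opoint K t q.2)) q.1 &
        slice_dy f K q = derive1 (fun t => f (opoint K q.1 t)) q.2].
  case: q => x' y' Oxy'; have [Dx Dy _ _ _] := fD K SK x' y' Oxy'.
  split; [exact: Dx | exact: Dy | exact: erefl | exact: erefl].
exact: (@C1_real_strict_derive R 8 (fun x y => f (opoint K x y)) _ x y
  (slice_dx f K) (slice_dy f K) (open_slice (K := K) oO) Oxy phiD cx cy).
Qed.

Lemma slice_CR K x y : oimag K -> Omega (opoint K x y) ->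
  slice_dx f K (x, y) + omul K (slice_dy f K (x, y)) = 0.
Proof.
case: reg => _ fD SK Oxy; have [_ _ _ _ /eqP] := fD K SK x y Oxy.
by rewrite scaler_eq0 invr_eq0 pnatr_eq0 => /eqP.
Qed.

End FixedFunction.

(* [v |-> v_k - i (L v)_k] is linear for the complex structure [L]. *)
Lemma complex_coord_strict_derivable n (L : {linear 'rV[R]_n -> 'rV[R]_n})
    (phi : R[i] -> 'rV[R]_n) a b p k :
  (forall v, L (L v) = - v) -> real_strict_derive phi a b p -> a + L b = 0 ->
  strict_derivable (fun z => phi z 0 k +i* (- L (phi z) 0 k)) p.
Proof.
move=> LL D /eqP; rewrite addr_eq0 => /eqP aE.
have bE : L a = b by rewrite aE linearN LL opprK.
have Lb : L b = - a by rewrite aE opprK.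
(* This is the [k]-th complex coordinate of [a], since [L a = b]. *)
exists (a 0 k +i* (- b 0 k)) => e e0.
have [K K0 LK] := linear_rV_bound L.
have K1 : 0 < K + 1 by rewrite addr_gt0.
have [d d0 hd] := D _ (divr_gt0 e0 K1); exists d => // z w zp wp.
have [v vE] : exists v, v = phi w - phi z -
    (complex.Re (w - z) *: a + complex.Im (w - z) *: b) by eexists.
have := hd z w zp wp; rewrite -vE => vle.
have Lv : L v = L (phi w) - L (phi z) -
    (complex.Re (w - z) *: b - complex.Im (w - z) *: a).
  move: vE; move: (complex.Re _) (complex.Im _) => s t ->.
  by rewrite 2!linearB linearD 2!linearZ /= bE Lb scalerN.
have vk : v 0 k = phi w 0 k - phi z 0 k -
    (complex.Re (w - z) * a 0 k + complex.Im (w - z) * b 0 k).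
  by rewrite vE !mxE.
have Lvk : L v 0 k = L (phi w) 0 k - L (phi z) 0 k -
    (complex.Re (w - z) * b 0 k - complex.Im (w - z) * a 0 k).
  by rewrite Lv !mxE.
have := le_trans (norm_coord_le (L v) k) (LK v); have := norm_coord_le v k.
rewrite (_ : _ - _ = v 0 k +i* (- L v 0 k)); last first.
  rewrite vk Lvk; move: (w - z) => [s t] /=.
  by congr Complex; ring.
move=> le1 le2; apply: le_trans (normc_le_ReIm _) _ => /=; rewrite normrN.
apply: (@le_trans _ _ ((K + 1) * `|v|)); first by lra.
by rewrite -ler_pdivlMl// mulrA (mulrC _^-1).
Qed.

(** When both maps square to -1, this operator [E] satisfies [LJ E = E LK], so it carries solutions
    of the equation for [LK] to solutions of the one for [LJ]. *)
Definition slice_ext n (LJ LK : {linear 'rV[R]_n -> 'rV[R]_n}) :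
    {linear 'rV[R]_n -> 'rV[R]_n} :=
  (- 2^-1) \*: idfun \+ 2^-1 \*: (LJ \o LK).

Lemma slice_ext_CR n (LJ LK : {linear 'rV[R]_n -> 'rV[R]_n}) a b :
  (forall v, LJ (LJ v) = - v) -> (forall v, LK (LK v) = - v) ->
  a + LK b = 0 -> slice_ext LJ LK a + LJ (slice_ext LJ LK b) = 0.
Proof.
move=> JJ KK /eqP; rewrite addr_eq0 => /eqP ->; rewrite /slice_ext /=.
rewrite linearD 2!linearZ /= (linearN LK) JJ KK opprK.
by move: (LJ b) (LK b) => ? ?; apply/rowP => k; rewrite !mxE; ring.
Qed.

Lemma slice_ext_sum n (LJ LI LN : {linear 'rV[R]_n -> 'rV[R]_n}) u v :
  (forall v, LN v = - LI v) ->
  slice_ext LJ LI u + slice_ext LJ LN v =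
  - (2^-1 *: (u + v) + 2^-1 *: LJ (LI (v - u))).
Proof.
move=> NI; rewrite /slice_ext /= NI 2!linearB linearN /=.
by apply/rowP => k; rewrite !mxE; ring.
Qed.

Lemma representation_formula Omega f I J x y :
  symmetric_slice_domain Omega -> slice_regular Omega f ->
  oimag I -> oimag J -> Omega (opoint J x y) ->
  f (opoint J x y) =
    2^-1 *: (f (opoint I x y) + f (opoint (- I) x y)) +
    2^-1 *: omul J (omul I (f (opoint (- I) x y) - f (opoint I x y))).
Proof.
move=> [[_ oO _] [x0 Ox0] slO symO] reg SI SJ Oxy.
have SN := oimagN SI.
pose ext K := slice_ext (omul_linear J) (omul_linear K).
(* The sign in [slice_ext] makes this sum the difference of the two sides of the formula. *)
pose h z := slice_fun f J z +
  (ext I (slice_fun f I z) + ext (- I) (slice_fun f (- I) z)).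
have omulK K : oimag K -> forall v, omul_linear K (omul_linear K v) = - v.
  by move=> SK v; exact: omul_imagK.
have ext_sum u v : ext I u + ext (- I) v =
    - (2^-1 *: (u + v) + 2^-1 *: omul J (omul I (v - u))).
  by apply: slice_ext_sum => w; exact: omulNl.
have hk k q : Omega (opoint J q.1 q.2) ->
    strict_derivable (fun z => h z 0 k +i* (- omul_linear J (h z) 0 k))
      (q.1 +i* q.2).
  case: q => x' y' /= OJ.
  have [OI ON] : Omega (opoint I x' y') /\ Omega (opoint (- I) x' y').
    by split; exact: symO OJ _ _.
  have D K := slice_real_strict_derive reg (K := K) (x := x') (y := y').
  have CR K SK OK : _ = 0 := slice_CR reg (K := K) (x := x') (y := y') SK OK.
  apply: (complex_coord_strict_derivable k (omulK J SJ)
    (real_strict_deriveD (D J SJ OJ) (real_strict_deriveD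
      (real_strict_derive_linear (ext I) (D I SI OI))
      (real_strict_derive_linear (ext (- I)) (D (- I) SN ON))))).
  rewrite [X in _ + X]linearD addrACA [X in _ + (_ + X)]linearD.
  rewrite (CR J SJ OJ) add0r addrACA.
  have E1 := slice_ext_CR (omulK J SJ) (omulK I SI) (CR I SI OI).
  have E2 := slice_ext_CR (omulK J SJ) (omulK (- I) SN) (CR (- I) SN ON).
  exact: etrans (f_equal2 +%R E1 E2) (addr0 0).
(* All slices of [f] agree on the real axis, so the [J I] term cancels and the mean is [f]
   itself. *)
have h_real (t : R) : h (t +i* 0) = 0.
  rewrite /h ext_sum /slice_fun /= !opoint0 subrr !omulr0 scaler0 addr0.
  by rewrite -mulr2n -(scaler_nat 2 (f _)) scalerA mulVf ?pnatr_eq0// scale1r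
    subrr.
have [_ _ cJ] := slO J SJ.
have h0 : h (x +i* y) = 0.
  apply/rowP => k; rewrite [RHS]mxE.
  have Ox0J : Omega (opoint J x0 0) by rewrite opoint0.
  have real0 (t : R) : Omega (opoint J t 0) ->
      h (t +i* 0) 0 k +i* (- omul_linear J (h (t +i* 0)) 0 k) = 0 :> R[i].
    by move=> _; rewrite h_real linear0 !mxE oppr0.
  exact: (congr1 (@complex.Re R) (identity_theorem (open_slice (K := J) oO)
    (connected_slice SJ cJ) (hk k) Ox0J real0 (q := (x, y)) Oxy)).
by apply/eqP; move/eqP: h0; rewrite /h ext_sum subr_eq0.
Qed.

End SliceRegular.

(** * The convex combination identity *)

Theorem proposition3p5 (R : realType) (Omega : set (octonion R))
    (f : octonion R -> octonion R) (I : octonion R) :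
  symmetric_slice_domain Omega ->
  slice_regular Omega f ->
  oimag I ->
  f @` (Omega `&` oslice I) `<=` oslice I ->
  forall (x y : R) (J : octonion R), oimag J -> Omega (opoint J x y) ->
    onorm (f (opoint J x y)) ^+ 2 =
      (1 + oinner I J) / 2 * onorm (f (opoint I x y)) ^+ 2 +
      (1 - oinner I J) / 2 * onorm (f (opoint I x (- y))) ^+ 2.
Proof.
move=> symO reg SI fI x y J SJ Oxy.
rewrite (representation_formula symO reg SI SJ Oxy) opointN.
have fP t : Omega (opoint I x t) -> exists a b, f (opoint I x t) = opoint I a b.
  move=> Ot; have [|a [b ->]] := fI (f (opoint I x t)); last by exists a, b.
  by exists (opoint I x t) => //; split => //; exists x, t.
case: symO => _ _ _ symO.
have [a [b ->]] := fP y (symO x y J SJ Oxy I SI).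
have := symO x y J SJ Oxy (- I) (oimagN SI).
rewrite opointN => /fP[c [d ->]].
(* With [f (x + y I) = a + b I] and [f (x - y I) = c + d I], the formula is put in the form
   [u + J v] with [u] and [v] in the slice of [I]. *)
have -> : 2^-1 *: (opoint I a b + opoint I c d) =
    opoint I ((a + c) / 2) ((b + d) / 2).
  by apply/rowP => k; rewrite !mxE; ring.
have -> : opoint I c d - opoint I a b = opoint I (c - a) (d - b).
  by apply/rowP => k; rewrite !mxE; ring.
rewrite omul_opoint// -omulZr.
have -> : 2^-1 *: opoint I (- (d - b)) (c - a) =
    opoint I ((b - d) / 2) ((c - a) / 2).
  by apply/rowP => k; rewrite !mxE; ring.
have nI p q : onorm (opoint I p q) ^+ 2 = p ^+ 2 + q ^+ 2.
  have := onorm_opoint_sum p q 0 0 SI SJ.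
  rewrite opoint0 scale0r omulr0 addr0 => ->; ring.
(* The coefficient of [t] is [(A - B) / 2] and the remaining terms add up to [(A + B) / 2]. *)
have convex A B t : A = a ^+ 2 + b ^+ 2 -> B = c ^+ 2 + d ^+ 2 ->
    ((a + c) / 2) ^+ 2 + ((b + d) / 2) ^+ 2 + ((b - d) / 2) ^+ 2 +
      ((c - a) / 2) ^+ 2 +
      2 * ((b + d) / 2 * ((b - d) / 2) - (a + c) / 2 * ((c - a) / 2)) * t =
    (1 + t) / 2 * A + (1 - t) / 2 * B by move=> -> ->; field.
exact: etrans (onorm_opoint_sum _ _ _ _ SI SJ) (convex _ _ _ (nI a b) (nI c d)).
Qed.
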